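(* Let $P$ be an Eulerian binomial poset with factorial function $B(n)$. Then exactly one of the following holds: (i) $B(n) = n!$ for all $n \geq 0$, and every $n$-interval of $P$ is isomorphic to the Boolean algebra $B_n$; or (ii) $B(0)=1$ and $B(n) = 2^{n-1}$ for all $n \geq 1$, and every $n$-interval of $P$ is isomorphic to the butterfly poset $T_n$.
   Context: All posets are locally finite with a unique minimal element $\hat{0}$. A binomial poset is such a poset $P$ that (i) contains an infinite chain, (ii) has every interval $[x,y]$ graded (so $P$ has a rank function $\rho$ with $\rho(\hat 0)=0$; $[x,y]$ is an $n$-interval if $\rho(y)-\rho(x)=n$), and (iii) for every $n\in\mathbb{N}$ any two $n$-intervals have the same number $B(n)$ of maximal chains; $B$ is the factorial function. A graded poset is Eulerian if its Möbius function satisfies $\mu(x,y) = (-1)^{\rho(y)-\rho(x)}$ for all $x \leq y$. $B_n$ is the Boolean algebra of all subsets of an $n$-element set ordered by inclusion. The butterfly poset $T_n$ ($n\ge 1$) is the graded poset of rank $n$ with a minimum $\hat 0$, a maximum $\hat 1$, and exactly two elements of each rank $1,\dots,n-1$, where every element of rank $k$ is below every element of rank $k+1$ (equivalently, an $n$-interval of the infinite butterfly poset $\{\hat 0\}\cup(\mathbb{P}\times\{1,2\})$ with $(k,i)\prec(k+1,j)$ for all $i,j$). *)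

(* Defs.v *)
From HB Require Import structures.
From mathcomp Require Import all_boot all_order all_algebra.
From mathcomp Require Import classical_sets cardinality fsbigop.

Set Implicit Arguments.
Unset Strict Implicit.
Unset Printing Implicit Defensive.

Import Order.TTheory GRing.Theory Num.Theory.
(* The inclusion order on {subset T}, which all_order leaves unexported. *)
Import preorder.Order.SetSubsetOrder.Exports.
Import order.Order.SetSubsetOrder.Exports.

Local Open Scope card_scope.
Local Open Scope classical_set_scope.
Local Open Scope order_scope.

Definition itv_set d (P : porderType d) (x y : P) : set P :=
  [set z | x <= z <= y].

Definition locally_finite d (P : porderType d) : Prop :=
  forall x y : P, finite_set (itv_set x y).

Definition has_infinite_chain d (P : porderType d) : Prop :=
  exists C : set P, infinite_set C /\ total_on C <=%O.

Definition chain_of d (P : porderType d) (x y : P) (C : set P) : Prop :=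
  C `<=` itv_set x y /\ total_on C <=%O.

Definition max_chains d (P : porderType d) (x y : P) : set (set P) :=
  [set C | chain_of x y C /\ forall D, chain_of x y D -> C `<=` D -> D = C].

(* A chain with n.+1 elements has length n. *)
Definition graded_itv d (P : porderType d) (x y : P) : Prop :=
  exists n : nat, forall C, max_chains x y C -> C #= `I_n.+1.

Definition covers d (P : porderType d) (x y : P) : Prop :=
  x < y /\ forall z, ~ (x < z < y).

(* In a locally finite poset with bottom all of whose intervals are graded,
   there is exactly one such function: it maps x to the length of the interval
   from \bot to x. *)
Definition rank_function d (P : bPOrderType d) (rho : P -> nat) : Prop :=
  rho \bot = 0%N /\ forall x y, covers x y -> rho y = (rho x).+1.

Definition n_interval d (P : porderType d) (rho : P -> nat) (n : nat)
  (x y : P) : Prop := x <= y /\ (rho y - rho x)%N = n.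

(* Because of the infinite chain, n-intervals exist for every n, so the
   function B is determined by P. *)
Record binomial_poset d (P : bPOrderType d) (rho : P -> nat) (B : nat -> nat)
    : Prop := BinomialPoset {
  binomial_locally_finite : locally_finite P;
  binomial_infinite_chain : has_infinite_chain P;
  binomial_graded : forall x y : P, x <= y -> graded_itv x y;
  binomial_rank : rank_function rho;
  binomial_factorial : forall (n : nat) (x y : P),
    n_interval rho n x y -> max_chains x y #= `I_(B n)
}.

(* The recursion determines mu x y whenever x <= y; the other values are
   irrelevant. *)
Definition mobius_function d (P : porderType d) (mu : P -> P -> int) : Prop :=
  (forall x, mu x x = 1%R) /\
  (forall x y, x < y -> (\sum_(z \in itv_set x y) mu x z)%R = 0%R).

Definition eulerian d (P : porderType d) (rho : P -> nat) : Prop :=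
  exists mu : P -> P -> int, mobius_function mu /\
    forall x y, x <= y -> mu x y = ((-1) ^+ (rho y - rho x)%N)%R.

Definition itv_isomorphic d (P : porderType d) (x y : P)
    d' (Q : porderType d') : Prop :=
  exists f : Q -> P, {mono f : a b / a <= b} /\ range f = itv_set x y.

Definition boolean_algebra (n : nat) :
  porderType preorder.Order.SetSubsetOrder.subset_display := {subset 'I_n}.

Lemma boolean_algebra_leE (n : nat) (A B : {set 'I_n}) :
  ((A : boolean_algebra n) <= B) = (A \subset B).
Proof. by []. Qed.

(* The pair (k, i) is the i-th element of rank k; only the ranks strictly
   between 0 and n have a second element. For n = 0 this is a single point. *)
Definition butterfly (n : nat) : Type :=
  {p : 'I_n.+1 * bool | p.2 ==> (0 < p.1 < n)%N}.

HB.instance Definition _ (n : nat) := Finite.on (butterfly n).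

Definition butterfly_rank (n : nat) (a : butterfly n) : nat := (val a).1.

(* Every rank from 0 to n is inhabited, so this is the reflexive transitive
   closure of "a has rank k and b has rank k + 1 for some k". *)
Definition butterfly_le (n : nat) (a b : butterfly n) : bool :=
  (a == b) || (butterfly_rank a < butterfly_rank b)%N.

Lemma butterfly_le_refl (n : nat) : reflexive (@butterfly_le n).
Proof. by move=> a; rewrite /butterfly_le eqxx. Qed.

Lemma butterfly_le_anti (n : nat) : antisymmetric (@butterfly_le n).
Proof.
move=> a b /andP[/orP[/eqP//|ab] /orP[/eqP//|ba]].
by move: (ltn_trans ab ba); rewrite ltnn.
Qed.

Lemma butterfly_le_trans (n : nat) : transitive (@butterfly_le n).
Proof.
move=> b a c /orP[/eqP->//|ab] /orP[/eqP<-|bc]; first by rewrite /butterfly_le ab orbT.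
by rewrite /butterfly_le (ltn_trans ab bc) orbT.
Qed.

Fact butterfly_display : Order.disp_t. Proof. exact: Order.Disp tt tt. Qed.

HB.instance Definition _ (n : nat) :=
  Order.Le_isPOrder.Build butterfly_display (butterfly n)
    (@butterfly_le_refl n) (@butterfly_le_anti n) (@butterfly_le_trans n).

Lemma butterfly_leE (n : nat) (a b : butterfly n) :
  (a <= b) = (a == b) || (butterfly_rank a < butterfly_rank b)%N.
Proof. by []. Qed.

(* Main.v *)
(* Write B(n) = A(n) B(n-1), where A(n) counts the atoms (and, by symmetry, the
   coatoms) of an n-interval; A is nondecreasing. An n-interval has
   B(n) / (B(k) B(n-k)) elements of rank k, so the Euler relation reads
   sum_k (-1)^k / (B(k) B(n-k)) = 0. For even n it determines
   1/B(n-1) - 1/B(n) in terms of the smaller values of B. As n! and 2^(n-1)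
   solve the same relations, this leaves an equation in A(n-1) and A(n) alone.
   For n = 4 it gives A(3) = 2 or A(3) = 3. In the second case monotonicity
   forces A(n) = n throughout; in the first it forces A(n) = 2, except for the
   values A(n-1) = 3, A(n) = 4, which are excluded by looking at the atoms of
   one (n-1)-interval.
   If B(n) = n!, each coatom of an interval lies above all atoms but one, and
   each atom below all coatoms but one; by induction an element is determined by
   the atoms below it, and every set of atoms occurs. If B(n) = 2^(n-1), the
   interval [x, w] below an element w of rank at least 2 contains both atoms of
   [x, y], and by induction elements of different ranks are comparable. *)
Require Import Defs.
From mathcomp Require Import all_boot all_order all_algebra.
From mathcomp Require Import finmap boolp classical_sets cardinality fsbigop.
From mathcomp Require Import zify ring lra.

Set Implicit Arguments.
Unset Strict Implicit.
Unset Printing Implicit Defensive.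

Import Order.TTheory GRing.Theory Num.Theory.

(** * Maximal chains in intervals of a poset *)

Section MaximalChains.
Local Open Scope card_scope.
Local Open Scope order_scope.
Local Open Scope classical_set_scope.
Context {d : Order.disp_t} {P : porderType d}.
Implicit Types (x y z u v : P) (C D : set P).

(** Maximality can be tested by adjoining one element at a time, because every element of a larger
    chain is comparable to all of [C]. *)
Lemma max_chainsP x y C : max_chains x y C <->
  chain_of x y C /\
  forall u, x <= u <= y -> (forall c, C c -> c >=< u) -> C u.
Proof.
split=> [[cC mC]|[cC iC]]; split=> //.
  move=> u xuy cu.
  have -> // : C = C `|` [set u]; last by right.
  apply/esym/mC; last by move=> t; left.
  split=> [t [/(proj1 cC)//|->//]|s t [Cs|->] [Ct|->]].
  - exact: (proj2 cC).
  - by apply/orP; exact: cu.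
  - by apply/orP; rewrite orbC; exact: cu.
  - by left; rewrite lexx.
move=> D [Dxy cD] CD; apply/seteqP; split=> // u Du; apply: iC; first exact: Dxy.
by move=> c /CD Dc; apply/orP; exact: cD.
Qed.

Lemma max_chains_le x y C c : max_chains x y C -> C c -> x <= c <= y.
Proof. by case=> -[sC _] _ /sC. Qed.

Lemma max_chains_total x y C c c' : max_chains x y C -> C c -> C c' -> c >=< c'.
Proof. by case=> -[_ tC] _ Cc Cc'; apply/orP; exact: tC. Qed.

Lemma max_chains_ge x y C u : max_chains x y C -> x <= u <= y ->
  (forall c, C c -> c >=< u) -> C u.
Proof. by move/max_chainsP=> [_]; exact. Qed.

Lemma max_chains_bot x y C : x <= y -> max_chains x y C -> C x.
Proof.
move=> xy mC; apply: (max_chains_ge mC); first by rewrite lexx.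
by move=> c /(max_chains_le mC)/andP[xc _]; rewrite /Order.comparable xc orbT.
Qed.

Lemma max_chains_top x y C : x <= y -> max_chains x y C -> C y.
Proof.
move=> xy mC; apply: (max_chains_ge mC); first by rewrite lexx andbT.
by move=> c /(max_chains_le mC)/andP[_ cy]; rewrite /Order.comparable cy.
Qed.

Lemma max_chains_restrict x y z C : max_chains x y C -> C z ->
  max_chains x z (C `&` itv_set x z) /\ max_chains z y (C `&` itv_set z y).
Proof.
move=> mC Cz; have /andP[xz zy] := max_chains_le mC Cz.
have tC s t : C s -> C t -> s <= t \/ t <= s.
  by move=> Cs Ct; apply/orP; exact: (max_chains_total mC).
split; apply/max_chainsP; split.
- by split=> [t []//|s t [Cs _] [Ct _]]; exact: tC.
- move=> u xuz cu; split=> //; have /andP[xu uz] := xuz.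
  apply: (max_chains_ge mC); first by rewrite xu (le_trans uz).
  move=> c Cc; have [cz|zc] := tC _ _ Cc Cz.
    by apply: cu; split=> //; rewrite /itv_set /= cz (andP (max_chains_le mC Cc)).1.
  by rewrite /Order.comparable (le_trans uz zc) orbT.
- by split=> [t []//|s t [Cs _] [Ct _]]; exact: tC.
- move=> u zuy cu; split=> //; have /andP[zu uy] := zuy.
  apply: (max_chains_ge mC); first by rewrite uy (le_trans xz).
  move=> c Cc; have [cz|zc] := tC _ _ Cc Cz.
    by rewrite /Order.comparable (le_trans cz zu).
  by apply: cu; split=> //; rewrite /itv_set /= zc (andP (max_chains_le mC Cc)).2.
Qed.

Lemma max_chains_union x y z C D : x <= z -> z <= y ->
  max_chains x z C -> max_chains z y D -> max_chains x y (C `|` D).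
Proof.
move=> xz zy mC mD; apply/max_chainsP; split; first split.
- move=> t [/(max_chains_le mC)|/(max_chains_le mD)] /andP[h1 h2].
    by rewrite /itv_set /= h1 (le_trans h2).
  by rewrite /itv_set /= h2 (le_trans xz).
- move=> s t [Cs|Ds] [Ct|Dt]; apply/orP.
  + exact: (max_chains_total mC).
  + have /andP[_ sz] := max_chains_le mC Cs; have /andP[zt _] := max_chains_le mD Dt.
    by rewrite (le_trans sz zt).
  + have /andP[_ tz] := max_chains_le mC Ct; have /andP[zs _] := max_chains_le mD Ds.
    by rewrite (le_trans tz zs) orbT.
  + exact: (max_chains_total mD).
move=> u /andP[xu uy] cu.
(* Comparability with [z] decides to which half of the chain [u] belongs. *)
have /orP[zu|uz] : z >=< u by apply: cu; left; exact: (max_chains_top xz mC).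
  right; apply: (max_chains_ge mD); first by rewrite zu.
  by move=> c Dc; apply: cu; right.
left; apply: (max_chains_ge mC); first by rewrite xu.
by move=> c Dc; apply: cu; left.
Qed.

(** Cutting a chain at [z] and uniting two halves are mutually inverse, since the halves share only
    [z]. *)
Lemma max_chains_through x y z : x <= z -> z <= y ->
  [set C | max_chains x y C /\ C z] #= max_chains x z `*` max_chains z y.
Proof.
move=> xz zy; set M := _ `*` _.
have inv C D : M (C, D) ->
    (C `|` D) `&` itv_set x z = C /\ (C `|` D) `&` itv_set z y = D.
  move=> [/= mC mD]; split; apply/seteqP; split=> t.
  - move=> [[//|Dt] /andP[_ tz]]; have /andP[zt _] := max_chains_le mD Dt.
    have -> : t = z by apply/le_anti; rewrite tz zt.
    exact: (max_chains_top xz mC).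
  - by move=> Ct; split; [left|exact: (max_chains_le mC)].
  - move=> [[Ct|//] /andP[zt _]]; have /andP[_ tz] := max_chains_le mC Ct.
    have -> : t = z by apply/le_anti; rewrite tz zt.
    exact: (max_chains_bot zy mD).
  - by move=> Dt; split; [right|exact: (max_chains_le mD)].
have -> : [set C | max_chains x y C /\ C z] =
    (fun p : set P * set P => p.1 `|` p.2) @` M.
  apply/seteqP; split=> [C [mC Cz]|_ [[C D] [/= mC mD] <-]].
    have [mC1 mC2] := max_chains_restrict mC Cz.
    exists (C `&` itv_set x z, C `&` itv_set z y) => //=.
    rewrite -setIUr; apply/setIidPl => t Ct.
    have /andP[xt ty] := max_chains_le mC Ct.
    by have /orP[tz|zt] := max_chains_total mC Ct Cz; [left|right]; apply/andP.
  split; first exact: max_chains_union mC mD.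
  by left; exact: (max_chains_top xz mC).
apply: inj_card_eq => -[C D] [C' D'] /set_mem MCD /set_mem MCD' /= E.
have [h1 h2] := inv _ _ MCD; have [h1' h2'] := inv _ _ MCD'.
by congr pair; [rewrite -h1 E h1'|rewrite -h2 E h2'].
Qed.

(** Zorn's lemma applies because a union of nested chains is again a chain. *)
Lemma max_chains_exist x y : exists C, max_chains x y C.
Proof.
have [F Fchain Ftot|C [cC mC]] := @Zorn_bigcup P (chain_of x y).
  split=> [t [C /Fchain[sC _] Ct]|s t [C FC Cs] [D FD Dt]]; first exact: sC.
  have [CD|DC] := Ftot _ _ FC FD.
    by have [_] := Fchain _ FD; apply=> //; exact: CD.
  by have [_] := Fchain _ FC; apply=> //; exact: DC.
exists C; split=> // D cD CD; apply: contrapT => nDC.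
apply: (mC D) => //; rewrite properEneq; split=> //.
by apply/eqP => CD'; apply: nDC.
Qed.

Lemma max_chains_refl x : max_chains x x = [set [set x]].
Proof.
have sub C : max_chains x x C -> C = [set x].
  move=> mC; apply/seteqP; split=> [t /(max_chains_le mC)|t ->].
    by rewrite -eq_le => /eqP.
  exact: (max_chains_bot _ mC).
by have [C mC] := max_chains_exist x x; apply/seteqP; split=> [D /sub//|D ->];
  rewrite -(sub C mC).
Qed.

Lemma max_chains_covers x y : covers x y -> max_chains x y = [set itv_set x y].
Proof.
move=> [xy cxy]; have sub C : max_chains x y C -> C = itv_set x y.
  move=> mC; apply/seteqP; split=> [t /(max_chains_le mC)//|t /andP[xt ty]].
  have [->|ntx] := eqVneq t x; first exact: (max_chains_bot (ltW xy) mC).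
  have [->|nty] := eqVneq t y; first exact: (max_chains_top (ltW xy) mC).
  by case: (cxy t); rewrite !lt_neqAle eq_sym ntx nty xt ty.
by have [C mC] := max_chains_exist x y; apply/seteqP; split=> [D /sub//|D ->];
  rewrite -(sub C mC).
Qed.

Hypothesis lfP : locally_finite P.

(** The size of an interval is the measure for the inductions below: an endpoint that moves strictly
    inward is lost. *)
Lemma ltn_card_itv x y x' y' : x <= y -> x <= x' -> y' <= y ->
  (x < x') || (y' < y) ->
  (#|` fset_set (itv_set x' y')| < #|` fset_set (itv_set x y)|)%N.
Proof.
move=> xy xx' y'y lt; apply: fproper_ltn_card; rewrite fproperEneq.
apply/andP; split; last first.
  rewrite -fset_set_sub// => t /andP[xt ty].
  by rewrite /itv_set /= (le_trans xx' xt) (le_trans ty y'y).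
apply/eqP=> /fset_set_inj => /(_ (lfP _ _) (lfP _ _)) E.
have : itv_set x' y' x by rewrite E /itv_set /= lexx.
have : itv_set x' y' y by rewrite E /itv_set /= lexx andbT.
move=> /andP[_ yy'] /andP[x'x _].
by case/orP: lt => /lt_geF; rewrite ?yy' ?x'x.
Qed.

(** With [Q] trivial, [w] covers [x]; with [Q] membership in a chain through [x], [w] is the next
    element of that chain. *)
Lemma least_above (Q : P -> Prop) x y : x < y -> Q y ->
  exists w, [/\ x < w <= y, Q w & forall u, x < u < w -> ~ Q u].
Proof.
have [n] := ubnP #|` fset_set (itv_set x y)|.
elim: n y => // n IH y /ltnSE le_n xy Qy.
have [[u [/andP[xu uy] Qu]]|no] := pselect (exists u, x < u < y /\ Q u); last first.
  by exists y; split=> [|//|u xuy Qu]; rewrite ?xy ?lexx//; apply: no; exists u.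
have [|w [/andP[xw wu] Qw mw]] := IH u _ xu Qu.
  by apply: leq_trans le_n; apply: ltn_card_itv;
    rewrite ?lexx ?(ltW xy) ?(ltW uy) ?uy ?orbT.
by exists w; rewrite xw (le_trans wu (ltW uy)).
Qed.

Lemma covers_below x y : x < y -> exists w, covers x w /\ w <= y.
Proof.
move=> xy; have [w [/andP[xw wy] _ mw]] := @least_above (fun=> True) x y xy I.
by exists w; split=> //; split=> // u /mw; exact.
Qed.

Lemma rank_lt rho x y : (forall u v, covers u v -> rho v = (rho u).+1) ->
  x < y -> (rho x < rho y)%N.
Proof.
move=> rhoS; have [n] := ubnP #|` fset_set (itv_set x y)|.
elim: n x => // n IH x /ltnSE le_n xy.
have [w [xw]] := covers_below xy; rewrite le_eqVlt => /orP[/eqP<-|wy].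
  by rewrite (rhoS _ _ xw).
apply: ltn_trans (IH w _ wy); first by rewrite (rhoS _ _ xw).
apply: leq_trans le_n; have [{}xw _] := xw.
by apply: ltn_card_itv; rewrite ?lexx ?(ltW xy) ?(ltW xw) ?xw.
Qed.

End MaximalChains.

(** * Counting in finite sets *)

Section FsetCard.
Local Open Scope fset_scope.

Lemma cardfsX (T U : choiceType) (A : {fset T}) (B : {fset U}) :
  #|` A `*` B| = (#|` A| * #|` B|)%N.
Proof.
rewrite -(size_allpairs pair); apply/perm_size/uniq_perm => //.
  by apply: allpairs_uniq => // -[? ?] [? ?].
move=> [x y]; rewrite in_fsetM; apply/idP/allpairsP => /= [/andP[Ax By]|].
  by exists (x, y).
by case=> -[u v] /= [Au Bv [-> ->]]; rewrite Au Bv.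
Qed.

Lemma cardfs_count (T : choiceType) (A : {fset T}) (p : pred T) :
  #|` [fset x in A | p x]| = count p A.
Proof.
rewrite -size_filter; apply/perm_size/uniq_perm; rewrite ?filter_uniq//.
by move=> x; rewrite mem_filter !inE andbC.
Qed.

(** Both products count the related pairs, once by rows and once by columns. *)
Lemma double_count (T U : choiceType) (A : {fset T}) (B : {fset U})
    (r : T -> U -> bool) (a b : nat) :
  (forall x, x \in A -> #|` [fset y in B | r x y]| = a) ->
  (forall y, y \in B -> #|` [fset x in A | r x y]| = b) ->
  (#|` A| * a = #|` B| * b)%N.
Proof.
move=> rA rB.
have -> : (#|` A| * a = \sum_(x <- A) \sum_(y <- B | r x y) 1)%N.
  rewrite -sum1_size big_distrl /= big_seq [RHS]big_seq.
  by apply: eq_bigr => x Ax; rewrite sum1_count -cardfs_count rA// mul1n.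
rewrite (exchange_big_dep predT)//= -sum1_size big_distrl /= big_seq [RHS]big_seq.
by apply: eq_bigr => y By; rewrite sum1_count -cardfs_count rB// mul1n.
Qed.

End FsetCard.

(** * The Euler relation as a recursion for the factorial function *)

Section EulerRelation.
Local Open Scope ring_scope.

(** This is the alternating sum of the level sizes of an [n]-interval divided by [B n], so that
    [B n] enters only through the first and last terms. *)
Definition euler_sum (B : nat -> nat) (n : nat) : rat :=
  \sum_(k < n.+1) (-1) ^+ k / (B k * B (n - k))%N%:R.

(** After multiplication by [n!] the sum is the binomial expansion of [(1 - 1) ^ n]. *)
Lemma euler_sum_factorial n : (0 < n)%N -> euler_sum factorial n = 0.
Proof.
move=> n0; have f0 m : m`!%:R != 0 :> rat by rewrite pnatr_eq0 -lt0n fact_gt0.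
apply: (mulfI (f0 n)); rewrite mulr0 mulr_sumr.
transitivity ((1 - 1) ^+ n : rat); last by rewrite subrr expr0n; case: n n0.
rewrite exprBn; apply: eq_bigr => k _.
rewrite !expr1n !mulr1 mulrCA -[RHS]mulr_natr; congr (_ * _).
rewrite -(bin_fact (m := k) (n := n)); last by rewrite -ltnS.
by rewrite [X in X / _]natrM mulfK// natrM mulf_neq0.
Qed.

(** All inner terms have the same absolute value, so only the parity of their number matters.
    Truncated subtraction gives the value 1 at [k = 0], as required of a factorial function. *)
Lemma euler_sum_pow2 n : (0 < n)%N -> euler_sum (fun k => 2 ^ (k - 1))%N n = 0.
Proof.
case: n => // n _; rewrite /euler_sum.
rewrite -(big_mkord predT (fun k =>
  (-1) ^+ k / (2 ^ (k - 1) * 2 ^ (n.+1 - k - 1))%N%:R)).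
rewrite big_nat_recr//= big_ltn//=.
have alt m : \sum_(1 <= k < m.+1) (-1) ^+ k = - (odd m)%:R :> rat.
  elim: m => [|m IH]; first by rewrite big_geq// oppr0.
  rewrite big_nat_recr//= IH exprS -signr_odd.
  by case: (odd m); rewrite /= ?expr0 ?expr1; lra.
rewrite (@eq_big_nat _ _ _ _ _ _ (fun k => (-1) ^+ k * (2 ^ (n - 1))%N%:R^-1)); last first.
  by move=> k /andP[k1 kn]; rewrite -expnD; congr (_ / (2 ^ _)%N%:R); lia.
rewrite -mulr_suml alt subn0 subSS subn0 subnn /= mul1n muln1.
rewrite exprS -[(-1) ^+ n]signr_odd; case: n => [|n]; first by rewrite /= expr0; field.
rewrite /= subSS subn0 expnS natrM.
have : (2 ^ n)%N%:R != 0 :> rat by rewrite pnatr_eq0 expn_eq0.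
by case: (odd n); rewrite /= ?expr0 ?expr1 => ?; field.
Qed.

(** The terms with [2 <= k <= n] involve only indices where [B] and [C] agree. As [n] is even, the
    terms at the two ends reinforce each other instead of cancelling, and leave the stated
    difference. *)
Lemma euler_sum_compare (B C : nat -> nat) n : (0 < n)%N -> ~~ odd n ->
  B 0 = 1%N -> B 1 = 1%N -> {in gtn n.+1, B =1 C} ->
  euler_sum B n.+2 = 0 -> euler_sum C n.+2 = 0 ->
  (B n.+1)%:R^-1 - (B n.+2)%:R^-1 = (C n.+1)%:R^-1 - (C n.+2)%:R^-1 :> rat.
Proof.
move=> n0 on B0 B1 BC.
have split (D : nat -> nat) : D 0 = 1%N -> D 1 = 1%N -> euler_sum D n.+2 =
    \sum_(2 <= k < n.+1) (-1) ^+ k / (D k * D (n.+2 - k))%N%:R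
    - 2 * ((D n.+1)%:R^-1 - (D n.+2)%:R^-1).
  move=> D0 D1.
  rewrite /euler_sum -(big_mkord predT (fun k => (-1) ^+ k / (D k * D (n.+2 - k))%N%:R)).
  rewrite big_nat_recr//= big_nat_recr//= big_ltn// big_ltn// subn0 subnn subSnn subn1 /=.
  rewrite D0 D1 !mul1n !muln1 !exprS -[(-1) ^+ n]signr_odd (negbTE on) expr0; lra.
have mid : \sum_(2 <= k < n.+1) (-1) ^+ k / (B k * B (n.+2 - k))%N%:R =
    \sum_(2 <= k < n.+1) (-1) ^+ k / (C k * C (n.+2 - k))%N%:R :> rat.
  by apply: eq_big_nat => k /andP[k2 kn]; rewrite !BC// inE; lia.
have C0 : C 0 = 1%N by rewrite -BC.
have C1 : C 1 = 1%N by rewrite -BC// inE ltnS.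
by rewrite (split B)// (split C)// mid; lra.
Qed.

(** Comparison with the factorials gives [(b - 1) / (a b) = 1 / (n + 2)]; the conclusion is this
    with denominators cleared and no subtraction. *)
Lemma factorial_step (B : nat -> nat) n a b : (0 < n)%N -> ~~ odd n ->
  {in gtn n.+1, B =1 factorial} -> (0 < a)%N -> (0 < b)%N ->
  B n.+1 = (a * B n)%N -> B n.+2 = (b * B n.+1)%N -> euler_sum B n.+2 = 0 ->
  (n.+2 * b = n.+2 + a * b)%N.
Proof.
move=> n0 on Bf a0 b0 Ba Bb EB.
have := euler_sum_compare n0 on (Bf 0%N isT) (Bf 1%N n0) Bf EB
  (euler_sum_factorial (ltn0Sn _)).
rewrite Bb Ba Bf ?inE// !factS !natrM => E.
have f0 : n`!%:R != 0 :> rat by rewrite pnatr_eq0 -lt0n fact_gt0.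
have {}a0 : a%:R != 0 :> rat by rewrite pnatr_eq0 -lt0n.
have {}b0 : b%:R != 0 :> rat by rewrite pnatr_eq0 -lt0n.
have n1 : n.+1%:R != 0 :> rat by rewrite pnatr_eq0.
have n2 : n.+2%:R != 0 :> rat by rewrite pnatr_eq0.
apply/eqP; rewrite -(eqr_nat rat) natrD !natrM; apply/eqP.
(* Multiply by a common denominator; both sides then keep the factor [n.+1], which is cancelled at
   the end. *)
move/(congr1 (fun t => t * (n.+2%:R * n.+1%:R * n`!%:R * a%:R * b%:R))) : E.
have -> : n.+2%:R = n.+1%:R + 1 :> rat by rewrite -natr1.
rewrite -[n.+2%:R]natr1 in n2; move: (n.+1%:R : rat) n1 n2 => m m0 m1.
have -> : ((a%:R * n`!%:R)^-1 - (b%:R * (a%:R * n`!%:R))^-1) *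
  ((m + 1) * m * n`!%:R * a%:R * b%:R) = m * ((m + 1) * b%:R - (m + 1)) :> rat.
  by field; rewrite f0 a0 b0.
have -> : ((m * n`!%:R)^-1 - ((m + 1) * (m * n`!%:R))^-1) *
  ((m + 1) * m * n`!%:R * a%:R * b%:R) = m * (a%:R * b%:R) :> rat.
  by field; rewrite f0 m0 m1.
by move/(mulfI m0); lra.
Qed.

(** Here the comparison gives [(b - 1) / (a b) = 1 / 4], whatever [n] is. *)
Lemma pow2_step (B : nat -> nat) n a b : (0 < n)%N -> ~~ odd n ->
  {in gtn n.+1, B =1 fun k => (2 ^ (k - 1))%N} -> (0 < a)%N -> (0 < b)%N ->
  B n.+1 = (a * B n)%N -> B n.+2 = (b * B n.+1)%N -> euler_sum B n.+2 = 0 ->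
  (4 * b = 4 + a * b)%N.
Proof.
move=> n0 on Bf a0 b0 Ba Bb EB.
have := euler_sum_compare n0 on (Bf 0%N isT) (Bf 1%N n0) Bf EB
  (euler_sum_pow2 (ltn0Sn _)).
rewrite Bb Ba Bf ?inE// !subSS !subn0.
case: n {on Bf Ba Bb EB} n0 => // n _; rewrite subSS subn0 !expnS !natrM => E.
have f0 : (2 ^ n)%N%:R != 0 :> rat by rewrite pnatr_eq0 expn_eq0.
have {}a0 : a%:R != 0 :> rat by rewrite pnatr_eq0 -lt0n.
have {}b0 : b%:R != 0 :> rat by rewrite pnatr_eq0 -lt0n.
apply/eqP; rewrite -(eqr_nat rat) natrD !natrM; apply/eqP.
move/(congr1 (fun t => t * (4 * (2 ^ n)%N%:R * a%:R * b%:R))) : E.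
have -> : ((a%:R * (2 ^ n)%N%:R)^-1 - (b%:R * (a%:R * (2 ^ n)%N%:R))^-1) *
  (4 * (2 ^ n)%N%:R * a%:R * b%:R) = 4 * b%:R - 4 :> rat.
  by field; rewrite f0 a0 b0.
have -> : ((2 * (2 ^ n)%N%:R)^-1 - (2 * (2 * (2 ^ n)%N%:R))^-1) *
  (4 * (2 ^ n)%N%:R * a%:R * b%:R) = a%:R * b%:R :> rat.
  by field.
by lra.
Qed.

End EulerRelation.

(** * Ranks, levels and atoms in binomial posets *)

Section BinomialPosets.
Local Open Scope card_scope.
Local Open Scope order_scope.
Local Open Scope classical_set_scope.
Local Open Scope fset_scope.
Context {d : Order.disp_t} {P : bPOrderType d} {rho : P -> nat} {B : nat -> nat}.
Hypothesis hP : binomial_poset rho B.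
Implicit Types (x y z u v w : P).

Let lfP : locally_finite P := binomial_locally_finite hP.

Lemma rho_lt x y : x < y -> (rho x < rho y)%N.
Proof. exact: (rank_lt lfP) (binomial_rank hP).2. Qed.

Lemma rho_le x y : x <= y -> (rho x <= rho y)%N.
Proof. by rewrite le_eqVlt => /orP[/eqP->//|/rho_lt/ltnW]. Qed.

Lemma rho_eq x y : x <= y -> rho x = rho y -> x = y.
Proof. by rewrite le_eqVlt => /orP[/eqP//|/rho_lt +] E; rewrite E ltnn. Qed.

(** Rank is monotone, so the truncated subtraction in [n_interval] loses nothing. *)
Lemma n_intervalP n x y :
  n_interval rho n x y <-> x <= y /\ rho y = (rho x + n)%N.
Proof. by split=> -[xy E]; split=> //; have := rho_le xy; lia. Qed.

(** In a maximal chain the next element after [z] covers [z], since anything strictly between would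
    be comparable to the whole chain. So ranks along it grow by one. *)
Lemma max_chains_rank x y C r : max_chains x y C -> x <= y ->
  (rho x <= r <= rho y)%N -> exists2 z, C z & rho z = r.
Proof.
move=> mC xy; elim: r => [|r IH] /andP[xr ry].
  by exists x; [exact: (max_chains_bot xy mC)|lia].
have [E|nE] := eqVneq (rho x) r.+1.
  by exists x => //; exact: (max_chains_bot xy mC).
have [|z Cz rz] := IH; first by apply/andP; lia.
have /andP[xz zy] := max_chains_le mC Cz.
have zy' : z < y by rewrite lt_neqAle zy andbT; apply/eqP=> E; move: ry; rewrite -E; lia.
have [w [/andP[zw wy] Cw mw]] := least_above lfP zy' (max_chains_top xy mC).
exists w => //; rewrite -rz; apply: (binomial_rank hP).2; split=> // u /andP[zu uw].
apply: (mw u); first by rewrite zu.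
apply: (max_chains_ge mC).
  by rewrite (le_trans xz (ltW zu)) (le_trans (ltW uw) wy).
move=> c Cc; have /orP[cz|] := max_chains_total mC Cc Cz.
  by rewrite /Order.comparable (le_trans cz (ltW zu)).
rewrite le_eqVlt => /orP[/eqP<-|zc]; first by rewrite /Order.comparable (ltW zu).
have /orP[cw|wc] := max_chains_total mC Cc Cw; last first.
  by rewrite /Order.comparable (le_trans (ltW uw) wc) orbT.
move: cw; rewrite le_eqVlt => /orP[/eqP->|cw].
  by rewrite /Order.comparable (ltW uw) orbT.
by case: (mw c); rewrite ?zc.
Qed.

Definition level x y k : {fset P} :=
  fset_set [set z | x <= z <= y /\ rho z = (rho x + k)%N]%classic.

Lemma in_level x y k z :
  (z \in level x y k) = (x <= z <= y) && (rho z == (rho x + k)%N).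
Proof.
rewrite in_fset_set; last by apply: sub_finite_set (lfP x y) => t [].
apply/idP/andP => [/set_mem[-> ->]//|[xzy /eqP rz]].
exact: mem_set.
Qed.

Lemma card_max_chains n x y : n_interval rho n x y ->
  #|` fset_set (max_chains x y)| = B n.
Proof. by move/(binomial_factorial hP)/card_fset_set. Qed.

Lemma finite_max_chains x y : x <= y -> finite_set (max_chains x y).
Proof.
by move=> xy; exists (B (rho y - rho x)%N); exact: (binomial_factorial hP).
Qed.

(** Count pairs of a maximal chain and a member of height [k]: each chain has exactly one such
    member, and [B k * B (n - k)] chains pass through each element of the level. *)
Lemma card_level n x y k : n_interval rho n x y -> (k <= n)%N ->
  (#|` level x y k| * (B k * B (n - k)) = B n)%N.
Proof.
move=> nxy kn; have [xy rxy] := (n_intervalP _ _ _).1 nxy.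
rewrite -(card_max_chains nxy) -[RHS]muln1; apply/esym.
apply: (double_count (r := fun (C : set P) (z : P) => z \in C)) => [C|z].
  rewrite in_fset_set ?inE; last exact: finite_max_chains.
  move=> mC; have [|z Cz rz] := max_chains_rank (r := (rho x + k)%N) mC xy.
    by apply/andP; lia.
  apply/eqP/cardfs1P; exists z; apply/fsetP => t; rewrite !inE in_level.
  apply/andP/eqP => [[/andP[_ /eqP rt]]|->]; last first.
    by rewrite rz eqxx (max_chains_le mC Cz) mem_set.
  rewrite inE => Ct; have /orP[h|h] := max_chains_total mC Ct Cz.
    by apply: rho_eq h _; lia.
  by apply/esym/(rho_eq h); lia.
rewrite in_level => /andP[/andP[xz zy] /eqP rz].
rewrite -(@card_max_chains k x z) -?(@card_max_chains (n - k) z y); first last.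
- by apply/n_intervalP; split=> //; lia.
- by apply/n_intervalP; split=> //; lia.
have fX : finite_set (max_chains x z `*` max_chains z y)%classic.
  by apply: finite_setX; exact: finite_max_chains.
rewrite -cardfsX -fset_setX; try exact: finite_max_chains.
transitivity #|` fset_set [set C | max_chains x y C /\ C z]%classic|.
  congr #|` _|; apply/fsetP => C; rewrite !inE in_fset_set; last exact: finite_max_chains.
  rewrite in_fset_set; last by rewrite (eq_finite_set (max_chains_through xz zy)).
  by apply/andP/idP; rewrite !inE.
have /finite_setP[m Hm] := fX; rewrite (card_fset_set Hm); apply: card_fset_set.
by rewrite (card_eql (max_chains_through xz zy)).
Qed.

Lemma factorial0 : B 0 = 1%N.
Proof.
rewrite -(@card_max_chains 0 \bot \bot) ?max_chains_refl ?fset_set1 ?cardfs1//.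
by apply/n_intervalP; rewrite addn0.
Qed.

(** Rank is injective on a chain, so an infinite chain has elements of arbitrarily large rank; a
    maximal chain from the bottom to one of them meets rank [n]. *)
Lemma n_interval_exists n : exists x y, n_interval rho n x y.
Proof.
have [C [infC totC]] := binomial_infinite_chain hP.
have [c Cc nc] : exists2 c, C c & (n <= rho c)%N.
  apply: contrapT => no; apply: infC.
  have inj : {in C &, injective rho}.
    move=> a b /set_mem Ca /set_mem Cb E.
    by have [h|h] := totC _ _ Ca Cb; [|apply: esym]; exact: rho_eq h _.
  rewrite -(eq_finite_set (inj_card_eq inj)).
  apply: sub_finite_set (finite_II n) => _ [c Cc <-] /=.
  by rewrite ltnNge; apply/negP => nc; apply: no; exists c.
have [C' mC'] := max_chains_exist \bot c.
have [|z Cz rz] := max_chains_rank (r := n) mC' (le0x c).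
  by rewrite (binomial_rank hP).1.
by exists \bot, z; apply/n_intervalP; rewrite le0x (binomial_rank hP).1.
Qed.

Lemma factorial_gt0 n : (0 < B n)%N.
Proof.
have [x [y nxy]] := n_interval_exists n; have [C mC] := max_chains_exist x y.
rewrite -(card_max_chains nxy) cardfs_gt0; apply/fset0Pn; exists C.
by rewrite in_fset_set ?inE//; apply: finite_max_chains; case: nxy.
Qed.

Lemma factorial1 : B 1 = 1%N.
Proof.
have [x [y nxy]] := n_interval_exists 1.
have [xy rxy] := (n_intervalP _ _ _).1 nxy.
rewrite -(card_max_chains nxy) max_chains_covers ?fset_set1 ?cardfs1//.
split; first by rewrite lt_neqAle xy andbT; apply/eqP=> E; move: rxy; rewrite E; lia.
by move=> z /andP[/rho_lt xz /rho_lt zy]; lia.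
Qed.

Definition atoms x y : {fset P} := level x y 1.

(** For positive [n] the division is exact, by [factorialS]. *)
Definition atom_number n : nat := B n %/ B n.-1.

Lemma card_atoms n x y : n_interval rho n.+1 x y ->
  #|` atoms x y| = atom_number n.+1.
Proof.
move=> nxy; have := card_level nxy (isT : 1 <= n.+1)%N.
rewrite subn1 factorial1 mul1n /atom_number => <-.
by rewrite mulnK// factorial_gt0.
Qed.

Lemma card_coatoms n x y : n_interval rho n.+1 x y ->
  #|` level x y n| = atom_number n.+1.
Proof.
move=> nxy; have := card_level nxy (leqnSn n).
rewrite subSnn factorial1 muln1 /atom_number => <-.
by rewrite mulnK// factorial_gt0.
Qed.

Lemma factorialS n : B n.+1 = (atom_number n.+1 * B n)%N.
Proof.
have [x [y nxy]] := n_interval_exists n.+1.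
by rewrite -(card_coatoms nxy) -(card_level nxy (leqnSn n)) subSnn factorial1 muln1.
Qed.

Lemma level_exists n x y k : n_interval rho n x y -> (k <= n)%N ->
  exists2 z, x <= z <= y & rho z = (rho x + k)%N.
Proof.
move=> nxy kn; have : (0 < #|` level x y k|)%N.
  by have := card_level nxy kn; have := factorial_gt0 n; nia.
rewrite cardfs_gt0 => /fset0Pn[z]; rewrite in_level => /andP[xzy /eqP rz].
by exists z.
Qed.

Lemma atoms_sub x y z : z <= y -> atoms x z `<=` atoms x y.
Proof.
move=> zy; apply/fsubsetP => a; rewrite !in_level => /andP[/andP[xa az] ->].
by rewrite xa (le_trans az zy).
Qed.

(** The atoms of [[x, c]], for a coatom [c] of [[x, y]], are atoms of [[x, y]]. *)
Lemma atom_number_mono n : (atom_number n.+1 <= atom_number n.+2)%N.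
Proof.
have [x [y nxy]] := n_interval_exists n.+2.
have [c /andP[xc cy] rc] := level_exists nxy (leqnSn _).
rewrite -(card_atoms nxy) -(@card_atoms n x c); last by apply/n_intervalP.
exact/fsubset_leq_card/atoms_sub.
Qed.

(** Group the defining sum of the Möbius function by height and divide by [B n]. *)
Lemma euler_sum_eq0 n : eulerian rho -> (0 < n)%N ->
  euler_sum B n = 0%R.
Proof.
move=> [mu [[_ mu0] muE]] n0; have [x [y nxy]] := n_interval_exists n.
have [xy rxy] := (n_intervalP _ _ _).1 nxy.
have lt_xy : x < y.
  by rewrite lt_neqAle xy andbT; apply/eqP=> E; move: rxy; rewrite E; lia.
have := mu0 _ _ lt_xy; rewrite fsbig_finite//=.
rewrite big_seq (eq_bigr (fun z => (-1) ^+ (rho z - rho x)%N)%R); last first.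
  by move=> z; rewrite in_fset_set// inE => /andP[xz _]; exact: muE.
(* Heights in [[x, y]] are at most [n], so [inord] never falls back to its default. *)
rewrite -big_seq (partition_big (fun z => inord (rho z - rho x) : 'I_n.+1) predT)//=.
move=> /(congr1 (fun t : int => t%:~R / (B n)%:R : rat)%R).
rewrite mul0r rmorph_sum mulr_suml => S0; rewrite -[RHS]S0; apply: eq_bigr => k _.
rewrite big_seq_cond (eq_bigr (fun=> (-1) ^+ k)%R); last first.
  move=> z; rewrite in_fset_set// => /andP[/set_mem/andP[/rho_le xz /rho_le zy] /eqP <-].
  by rewrite inordK//; lia.
have kn : (k <= n)%N by rewrite -ltnS.
rewrite -(card_level nxy kn) big_const_seq iter_addr_0.
set c := count _ _; have -> : c = #|` level x y k|.
  rewrite /c -cardfs_count; congr #|` _|; apply/fsetP => z.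
  rewrite in_level !inE in_fset_set//=.
  have -> : (z \in itv_set x y) = (x <= z <= y) by apply/idP/idP; rewrite inE.
  rewrite andbA andbb; case: (boolP (x <= z <= y)) => //= /andP[/rho_le xz /rho_le zy].
  rewrite -val_eqE /= inordK; last by lia.
  by apply/eqP/eqP; lia.
have L0 : (#|` level x y k|%:R != 0 :> rat)%R.
  rewrite pnatr_eq0; apply/eqP=> L0; have := card_level nxy kn.
  by have := factorial_gt0 n; rewrite L0; lia.
rewrite rmorphMn rmorphXn rmorphN1 -[((-1) ^+ k *+ _)%R]mulr_natl.
(* The level size cancels against the same factor of [B n]. *)
by rewrite [X in _ = (_ / X)%R]natrM invfM mulrACA divff// mul1r.
Qed.

Lemma atom_number_gt0 n : (0 < atom_number n.+1)%N.
Proof. by have := factorialS n; have := factorial_gt0 n.+1; nia. Qed.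

Lemma atoms_interval n x y z : n_interval rho n.+1 x y -> z \in atoms x y ->
  n_interval rho n z y.
Proof.
move=> /n_intervalP[xy rxy]; rewrite in_level => /andP[/andP[_ zy] /eqP rz].
by apply/n_intervalP; split=> //; lia.
Qed.

Lemma atoms_eq n m x c y : c <= y -> n_interval rho n.+1 x c ->
  n_interval rho m.+1 x y -> atom_number n.+1 = atom_number m.+1 ->
  atoms x c = atoms x y.
Proof.
move=> cy xc xy E; apply/eqP.
by rewrite eqEfcard atoms_sub// (card_atoms xc) (card_atoms xy) E /=.
Qed.

(* Were there a third atom s, not below the coatom c, then an element r of
   rank 2 above s would lie above an atom s' of [x, c]; but all atoms of
   [s', y] are atoms of [s', c], so s <= r <= c. *)
Lemma atom_number_neq3 n : atom_number 2 = 2 -> atom_number n.+2 = 2 ->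
  atom_number n.+3 = 2 -> atom_number n.+4 != 3.
Proof.
move=> A2 An2 An3; apply/eqP => An4.
have [x [y nxy]] := n_interval_exists n.+4.
have [xy rxy] := (n_intervalP _ _ _).1 nxy.
have [c /andP[xc cy] rc] := level_exists nxy (leqnSn _).
have nxc : n_interval rho n.+3 x c by apply/n_intervalP.
have [s sxy nsc] : exists2 s, s \in atoms x y & s \notin atoms x c.
  apply/fsubsetPn/negP => /fsubset_leq_card.
  by rewrite (card_atoms nxy) (card_atoms nxc) An3 An4.
have axy : atoms x y = s |` atoms x c.
  apply/esym/eqP; rewrite eqEfcard cardfsU1 nsc (card_atoms nxy) (card_atoms nxc).
  by rewrite An3 An4 leqnn andbT fsubUset fsub1set sxy atoms_sub.
have nsy := atoms_interval nxy sxy.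
have [r /andP[sr ry] rr] := level_exists nsy (isT : 1 <= n.+3)%N.
move: (sxy); rewrite in_level => /andP[/andP[xs sy] /eqP rs].
have xr := le_trans xs sr.
have nxr : n_interval rho 2 x r by apply/n_intervalP; rewrite rr rs -addnA.
have [s' s'xr s's] : exists2 s', s' \in atoms x r & s' != s.
  have : (0 < #|` atoms x r `\ s|)%N.
    have := cardfsD1 s (atoms x r); rewrite (card_atoms nxr) A2.
    by case: (_ \in _) => /=; [rewrite add1n => -[<-]|rewrite add0n => <-].
  rewrite cardfs_gt0 => /fset0Pn[s']; rewrite in_fsetD1 => /andP[? ?].
  by exists s'.
have s'xy := fsubsetP (atoms_sub x ry) _ s'xr.
have s'xc : s' \in atoms x c by move: s'xy; rewrite axy in_fset1U (negbTE s's).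
have : r \in atoms s' c.
  rewrite (atoms_eq cy (atoms_interval nxc s'xc) (atoms_interval nxy s'xy)) ?An2//.
  move: s'xr; rewrite !in_level ry andbT => /andP[/andP[_ ->] /eqP ->] /=.
  by rewrite rr rs.
rewrite in_level => /andP[/andP[_ rlec] _].
by move/negP: nsc; apply; rewrite in_level xs (le_trans sr rlec) rs eqxx.
Qed.

(** * The two possible factorial functions in the Eulerian case *)

Hypothesis eP : eulerian rho.

(** The Euler relation of order 2 reads [2 / B 2 - 1 = 0]. *)
Lemma factorial2 : B 2 = 2.
Proof.
have := euler_sum_eq0 eP (isT : 0 < 2)%N; rewrite /euler_sum !big_ord_recl big_ord0 /=.
rewrite /bump /= factorial0 factorial1 !mul1n !muln1.
have B0 : ((B 2)%:R != 0 :> rat)%R by rewrite pnatr_eq0 -lt0n factorial_gt0.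
move=> E; apply/eqP; rewrite -(eqr_nat rat); apply/eqP.
move/(congr1 (fun t => t * (B 2)%:R)%R) : E.
rewrite mul0r !mulrDl mulfVK// !exprS expr0 ?expr1.
lra.
Qed.

Lemma atom_number2 : atom_number 2 = 2.
Proof. by rewrite /atom_number factorial1 factorial2. Qed.

Lemma atom_number_factorial n : (0 < n)%N -> B n = n`! -> B n.-1 = n.-1`! ->
  atom_number n = n.
Proof.
by case: n => // n _ /= Bn Bn1; rewrite /atom_number Bn Bn1 factS mulnK// fact_gt0.
Qed.

Lemma atom_number_pow2 n : B n.+2 = (2 ^ n.+1)%N -> B n.+1 = (2 ^ n)%N ->
  atom_number n.+2 = 2.
Proof.
by move=> Bn Bn1; rewrite /atom_number Bn Bn1 expnS mulnK// expn_gt0.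
Qed.

(** The relation of order 4 reads [(4 - a) b = 4] with [a = A(3)] and [b = A(4)], hence [a < 4];
    monotonicity gives [a >= 2]. *)
Lemma atom_number3 : atom_number 3 = 2 \/ atom_number 3 = 3.
Proof.
have h : {in gtn 3, B =1 factorial}.
  by case=> [|[|[|//]]] _; rewrite ?factorial0 ?factorial1 ?factorial2.
have := factorial_step (n := 2) isT isT h (atom_number_gt0 2) (atom_number_gt0 3)
  (factorialS 2) (factorialS 3) (euler_sum_eq0 eP (ltn0Sn _)).
have := atom_number_mono 1; rewrite atom_number2.
have : (atom_number 3 < 4)%N \/ (4 <= atom_number 3)%N by lia.
case=> h1 h2; last by nia.
by move=> _; lia.
Qed.

Lemma factorial_boolean n : atom_number 3 = 3 -> B n = n`!.
Proof.
move=> A3.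
(* Each relation of even order settles two new values, so the induction advances by two indices. *)
suff H m : {in gtn (m.*2).+3, B =1 factorial} by apply: (H n); rewrite inE; lia.
elim: m => [|m IH].
  by case=> [|[|[|//]]] _; rewrite ?factorial0 ?factorial1 ?factorial2.
set k := (m.*2).+2 in IH *.
have step := factorial_step (isT : 0 < k)%N _ IH (atom_number_gt0 k)
  (atom_number_gt0 k.+1) (factorialS k) (factorialS k.+1) (euler_sum_eq0 eP (ltn0Sn _)).
have {}step := step ltac:(by rewrite /k /= odd_double).
have Ak : atom_number k = k.
  by apply: atom_number_factorial => //; apply: IH; rewrite inE /k /=; lia.
have a1 := atom_number_mono (m.*2).+1; rewrite -/k Ak in a1.
have a2 := atom_number_mono k.
(* Solve [(k + 2 - a) b = k + 2] with [k <= a <= b]. The choice [a = k] would give [2 b = k + 2],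
   possible only for [k = 2], where [A3] excludes it. *)
have [Ea Eb] : atom_number k.+1 = k.+1 /\ atom_number k.+2 = k.+2.
  have [m0|m0] := posnP m.
    by move: step; rewrite /k m0 A3; lia.
  have : (2 < k)%N by rewrite /k; lia.
  move: step a1 a2; move: (atom_number _) (atom_number _) => a b.
  move=> step a1 a2 k2; have [h|h] : (a < k.+2)%N \/ (k.+2 <= a)%N by lia.
    have [E|E] : a = k \/ a = k.+1 by lia.
      by move: step; rewrite E; nia.
    by split=> //; move: step; rewrite E; nia.
  by nia.
have B1 : B k.+1 = k.+1`! by rewrite factorialS Ea IH ?inE.
have B2 : B k.+2 = k.+2`! by rewrite factorialS Eb B1.
move=> j; rewrite inE doubleS -/k => jk.
have [h|[->|->]] : (j < k.+1)%N \/ j = k.+1 \/ j = k.+2 by lia.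
- by apply: IH; rewrite inE.
- exact: B1.
- exact: B2.
Qed.

Lemma factorial_butterfly n : atom_number 3 = 2 -> B n = (2 ^ (n - 1))%N.
Proof.
move=> A3.
suff H m : {in gtn (m.*2).+3, B =1 fun k => (2 ^ (k - 1))%N}.
  by apply: (H n); rewrite inE; lia.
elim: m => [|m IH].
  by case=> [|[|[|//]]] _; rewrite ?factorial0 ?factorial1 ?factorial2.
set k := (m.*2).+2 in IH *.
have step := pow2_step (isT : 0 < k)%N _ IH (atom_number_gt0 k)
  (atom_number_gt0 k.+1) (factorialS k) (factorialS k.+1) (euler_sum_eq0 eP (ltn0Sn _)).
have {}step := step ltac:(by rewrite /k /= odd_double).
have Alow j : (j.+2 <= k)%N -> atom_number j.+2 = 2.
  move=> jk; apply: atom_number_pow2; rewrite IH ?inE; try lia.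
    by congr (2 ^ _); lia.
  by congr (2 ^ _); lia.
have a1 := atom_number_mono (m.*2).+1; rewrite -/k Alow// in a1.
have a2 := atom_number_mono k.
(* The solutions of [(4 - a) b = 4] with [2 <= a <= b] are [(2, 2)] and [(3, 4)]; the second is
   excluded by [A3] for [k = 2] and by [atom_number_neq3] beyond. *)
have [Ea Eb] : atom_number k.+1 = 2 /\ atom_number k.+2 = 2.
  have nA3 : atom_number k.+1 <> 3.
    have [m0|m0] := posnP m; first by rewrite /k m0 A3.
    have Ek : k = (k - 3).+3 by rewrite /k; lia.
    apply/eqP; rewrite [in X in atom_number X.+1]Ek.
    by apply: atom_number_neq3; rewrite ?atom_number2// Alow//; lia.
  move: step a1 a2 nA3; move: (atom_number _) (atom_number _) => a b.
  by move=> step a1 a2 a3; nia.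
have B1 : B k.+1 = (2 ^ k)%N.
  by rewrite factorialS Ea IH ?inE// -expnS; congr (2 ^ _); rewrite /k; lia.
have B2 : B k.+2 = (2 ^ k.+1)%N by rewrite factorialS Eb B1 -expnS.
move=> j; rewrite inE doubleS -/k => jk.
have [h|[->|->]] : (j < k.+1)%N \/ j = k.+1 \/ j = k.+2 by lia.
- by apply: IH; rewrite inE.
- by rewrite B1 subn1.
- by rewrite B2 subn1.
Qed.

(** * Intervals when the factorial function is [n!] *)

Section BooleanIntervals.
Hypothesis Bfact : forall n, B n = n`!.

Lemma boolean_card_atoms n x y : n_interval rho n x y -> #|` atoms x y| = n.
Proof.
case: n => [|n] nxy; last first.
  by rewrite (card_atoms nxy) (@atom_number_factorial n.+1) ?Bfact.
have [xy rxy] := (n_intervalP _ _ _).1 nxy.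
apply/eqP; rewrite cardfs_eq0; apply/eqP/fsetP => a; rewrite in_level in_fset0.
by apply/negbTE/negP => /andP[/andP[_ /rho_le ay] /eqP ra]; lia.
Qed.

Lemma boolean_card_coatoms n x y : n_interval rho n.+1 x y ->
  #|` level x y n| = n.+1.
Proof.
by move=> nxy; rewrite (card_coatoms nxy) (@atom_number_factorial n.+1) ?Bfact.
Qed.

Lemma in_atoms_le x y c a : a \in atoms x y -> (a \in atoms x c) = (a <= c).
Proof. by rewrite !in_level => /andP[/andP[-> _] ->]; rewrite andbT. Qed.

Lemma level_interval n x y c : c \in level x y n ->
  n_interval rho n x c.
Proof.
by rewrite in_level => /andP[/andP[xc _] /eqP rc]; apply/n_intervalP.
Qed.

(** The interval [[x, c]] contains [n] of the [n.+1] atoms. *)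
Lemma card_omitted_atoms n x y c : n_interval rho n.+1 x y ->
  c \in level x y n -> #|` [fset a in atoms x y | ~~ (a <= c)]| = 1.
Proof.
move=> nxy cc; have cy : c <= y by move: cc; rewrite in_level => /andP[/andP[]].
have := cardfsID (atoms x c) (atoms x y).
rewrite (fsetIidPr (atoms_sub x cy)) (boolean_card_atoms (level_interval cc)).
rewrite (boolean_card_atoms nxy).
have -> : [fset a in atoms x y | ~~ (a <= c)] = atoms x y `\` atoms x c.
  apply/fsetP => a; rewrite in_fsetD !in_fset /= inE /= andbC.
  case: (boolP (a \in atoms x y)) => [axy|]; last by rewrite !andbF.
  by rewrite (in_atoms_le _ axy).
lia.
Qed.

(** The coatoms above [a] are the coatoms of [[a, y]], which are [n] of the [n.+1]. *)
Lemma card_omitting_coatoms n x y a : n_interval rho n.+1 x y ->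
  a \in atoms x y -> #|` [fset c in level x y n | ~~ (a <= c)]| = 1.
Proof.
move=> nxy axy; have nay := atoms_interval nxy axy.
move: (axy); rewrite in_level => /andP[/andP[xa ay] /eqP ra].
have E : #|` [fset c in level x y n | a <= c]| = n.
  (* In a 1-interval [a] is [y], and the only coatom is [x], which is not above it. *)
  case: n nxy nay axy => [|n] nxy nay axy.
    apply/eqP; rewrite cardfs_eq0; apply/eqP/fsetP => c; rewrite in_fset0.
    rewrite in_fset /= inE /= in_level; apply/negbTE/negP.
    by move=> /andP[/andP[_ /eqP rc] /rho_le]; lia.
  rewrite -[RHS](boolean_card_coatoms nay); congr #|` _|; apply/fsetP => c.
  rewrite in_fset /= inE /= !in_level.
  have -> : (rho c == rho x + n.+1)%N = (rho c == rho a + n)%N by rewrite ra; lia.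
  case: (boolP (a <= c)) => [ac|]; last by rewrite andbF.
  by rewrite (le_trans xa ac) andbT.
have := count_predC (fun c => a <= c) (level x y n).
rewrite -[count (fun c => _) _]cardfs_count E (boolean_card_coatoms nxy).
by rewrite cardfs_count (@eq_count _ _ (predC (fun c => a <= c)))//; lia.
Qed.

(* Both [U] and [V] below have as many elements as there are atoms not below z:
   omission is a bijection between coatoms and atoms. *)
Lemma le_coatom n x y z c : n_interval rho n.+1 x y -> x <= z <= y ->
  c \in level x y n -> atoms x z `<=` atoms x c -> z <= c.
Proof.
move=> nxy /andP[xz zy] cc zc.
have rz := rho_le xz; have rzy := rho_le zy.
have [xy rxy] := (n_intervalP _ _ _).1 nxy.
have nxz : n_interval rho (rho z - rho x) x z by [].
have nzy : n_interval rho (rho y - rho z) z y by [].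
have card_z := boolean_card_atoms nxz.
have card_c := boolean_card_atoms (level_interval cc).
have lt_z : (rho z < rho y)%N.
  by have := fsubset_leq_card zc; rewrite card_z card_c; lia.
have [m Em] : exists m, (rho y - rho z = m.+1)%N by exists (rho y - rho z).-1; lia.
rewrite Em in nzy; have card_U := boolean_card_coatoms nzy.
set U := level z y m in card_U.
pose V := [fset c' in level x y n | atoms x z `<=` atoms x c'].
have UV : U `<=` V.
  apply/fsubsetP => c'; rewrite in_level => /andP[/andP[zc' c'y] /eqP rc'].
  rewrite in_fset /= inE /= in_level (le_trans xz zc') c'y atoms_sub// andbT.
  by apply/eqP; lia.
have card_V : #|` V| = m.+1.
  have E : #|` atoms x y `\` atoms x z| = m.+1.
    have := cardfsID (atoms x z) (atoms x y).
    by rewrite (fsetIidPr (atoms_sub x zy)) card_z (boolean_card_atoms nxy); lia.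
  rewrite -E -[LHS]muln1 -[RHS]muln1.
  apply: (double_count (r := fun c a : P => ~~ (a <= c))) => [c' |a].
    rewrite in_fset /= inE /= => /andP[c'c zc'].
    rewrite -(card_omitted_atoms nxy c'c); congr #|` _|; apply/fsetP => a.
    rewrite !in_fset /= !inE /=.
    case: (boolP (a \in atoms x z)) => //= az.
    have := fsubsetP zc' _ az; have axy := fsubsetP (atoms_sub x zy) _ az.
    by rewrite (in_atoms_le _ axy) => ->; rewrite andbF.
  rewrite in_fsetD => /andP[az axy].
  rewrite -(card_omitting_coatoms nxy axy); congr #|` _|; apply/fsetP => c'.
  rewrite !in_fset /= !inE /=.
  case: (boolP (c' \in level x y n)) => //= c'c.
  case: (boolP (a <= c')) => //= ac'; rewrite ?andbF// andbT.
  apply/fsubsetP => b bz; have bxy := fsubsetP (atoms_sub x zy) _ bz.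
  rewrite (in_atoms_le _ bxy); apply: contraT => bc'.
  have /eqP/cardfs1P[t Et] := card_omitted_atoms nxy c'c.
  have : a \in [fset t] by rewrite -Et in_fset /= inE /= axy.
  have : b \in [fset t] by rewrite -Et in_fset /= inE /= bxy.
  by rewrite !in_fset1 => /eqP bt /eqP at_; move: az; rewrite at_ -bt bz.
have : c \in U.
  have -> : U = V by apply/eqP; rewrite eqEfcard UV card_U card_V /=.
  by rewrite in_fset /= inE /= cc.
by rewrite in_level => /andP[/andP[]].
Qed.

(** If [w] is not [y], some coatom lies above [w], and by [le_coatom] also above [z]; the induction
    continues below that coatom. *)
Lemma boolean_atoms_le n x y z w : n_interval rho n x y ->
  x <= z <= y -> x <= w <= y -> atoms x z `<=` atoms x w -> z <= w.
Proof.
elim: n y => [|n IH] y nxy /andP[xz zy] /andP[xw wy] zw;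
    have [xy rxy] := (n_intervalP _ _ _).1 nxy.
  have -> : z = x by apply/esym/rho_eq => //; have := rho_le zy; have := rho_le xz; lia.
  by [].
have [->//|nwy] := eqVneq w y.
have rwy : (rho w < rho y)%N by apply: rho_lt; rewrite lt_neqAle nwy.
have rxw := rho_le xw.
have nwy' : n_interval rho (rho y - rho w) w y by [].
have [c /andP[wc cy] rc] := level_exists nwy' (leq_pred _).
have cc : c \in level x y n.
  by rewrite in_level (le_trans xw wc) cy rc; apply/eqP; lia.
have zc : z <= c.
  apply: (le_coatom nxy _ cc); first by rewrite xz.
  exact: fsubset_trans zw (atoms_sub x wc).
by apply: IH (level_interval cc) _ _ zw; apply/andP.
Qed.

(** If [S] misses an atom [a], a coatom omitting [a] omits no other atom, so [S] consists of atoms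
    below it and the induction applies there. *)
Lemma boolean_atoms_exist n x y (S : {fset P}) : n_interval rho n x y ->
  S `<=` atoms x y -> exists2 z, x <= z <= y & atoms x z = S.
Proof.
elim: n y => [|n IH] y nxy Sxy.
  have [xy _] := nxy; exists y; first by rewrite xy lexx.
  apply/eqP; rewrite eq_sym eqEfcard Sxy (boolean_card_atoms nxy).
  by [].
have [->|nS] := eqVneq S (atoms x y).
  by have [xy _] := nxy; exists y; rewrite ?xy ?lexx.
have [a axy aS] : exists2 a, a \in atoms x y & a \notin S.
  by apply/fsubsetPn; apply: contra nS => h; rewrite eqEfsubset Sxy.
have : (0 < #|` [fset c in level x y n | ~~ (a <= c)%O]|)%N.
  by rewrite (card_omitting_coatoms nxy axy).
rewrite cardfs_gt0 => /fset0Pn[c]; rewrite in_fset /= inE /= => /andP[cc ac].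
have [|z /andP[xz zc] Sz] := IH c (level_interval cc).
  apply/fsubsetP => b bS; have bxy := fsubsetP Sxy _ bS.
  rewrite (in_atoms_le _ bxy); apply: contraT => bc.
  have /eqP/cardfs1P[t Et] := card_omitted_atoms nxy cc.
  have : a \in [fset t] by rewrite -Et in_fset /= inE /= axy.
  have : b \in [fset t] by rewrite -Et in_fset /= inE /= bxy.
  by rewrite !in_fset1 => /eqP bt /eqP at_; move: aS; rewrite at_ -bt bS.
have cy : c <= y by move: cc; rewrite in_level => /andP[/andP[]].
by exists z; rewrite // xz (le_trans zc).
Qed.

(** With the atoms numbered, a set of indices goes to the element having exactly those atoms, and an
    element [z] comes from the indices of the atoms below it. *)
Lemma boolean_isomorphic n x y : n_interval rho n x y ->
  itv_isomorphic x y (boolean_algebra n).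
Proof.
move=> nxy; have [xy rxy] := (n_intervalP _ _ _).1 nxy.
have size_n := boolean_card_atoms nxy.
pose e (i : 'I_n) := nth x (atoms x y) i.
have e_inj : injective e.
  move=> i j /eqP; rewrite nth_uniq ?size_n ?fset_uniq//.
  by move=> /eqP/val_inj.
have e_atom i : e i \in atoms x y by rewrite mem_nth// size_n.
pose S (A : {set 'I_n}) : {fset P} := [fset e i | i in A].
have memS A i : (e i \in S A) = (i \in A).
  by apply/imfsetP/idP => [[j /= jA /e_inj->//]|iA]; exists i.
have SP A : exists z, x <= z <= y /\ atoms x z = S A.
  have [|z xzy Sz] := @boolean_atoms_exist n x y (S A) nxy.
    by apply/fsubsetP => _ /imfsetP[i _ ->].
  by exists z.
have [f fP] := choice SP.
exists f; split=> [A A'|].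
  have [xAy fA] := fP A; have [xA'y fA'] := fP A'.
  rewrite boolean_algebra_leE; apply/idP/fintype.subsetP => [le_f i|AA'].
    by rewrite -!memS -fA -fA'; apply/fsubsetP/atoms_sub.
  apply: (boolean_atoms_le nxy) => //; rewrite fA fA'.
  by apply/fsubsetP => _ /imfsetP[i /= /AA' iA ->]; rewrite memS.
apply/seteqP; split=> [_ [A _ <-]|z xzy]; first by have [] := fP A.
exists [set i | e i <= z]%SET => //.
set A := [set i | _]%SET; have [xAy fA] := fP A.
have Sz : S A = atoms x z.
  have /andP[xz zy] := xzy.
  apply/fsetP => a; apply/idP/idP.
    move=> /imfsetP[i /=]; rewrite inE => ez ->.
    by move: (e_atom i); rewrite !in_level ez => /andP[/andP[-> _] ->].
  move=> az; have axy := fsubsetP (atoms_sub x zy) _ az.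
  have ia : (index a (atoms x y) < n)%N by rewrite -size_n index_mem.
  have -> : a = e (Ordinal ia) by rewrite /e /= nth_index.
  rewrite memS inE /e /= nth_index//.
  by move: az; rewrite in_level => /andP[/andP[]].
by apply/le_anti/andP; split; apply: (boolean_atoms_le nxy); rewrite // fA Sz.
Qed.

End BooleanIntervals.

(** * Intervals when the factorial function is [2 ^ (n - 1)] *)

Section ButterflyIntervals.
Hypothesis Bpow2 : forall n, B n = (2 ^ (n - 1))%N.

Lemma butterfly_atom_number n : atom_number n.+2 = 2.
Proof. by rewrite atom_number_pow2 // Bpow2 subn1. Qed.

(** The boolean is coerced to a number: strictly inside, the powers of 2 leave a quotient 2, while
    at the ends truncated subtraction makes it 1. *)
Lemma butterfly_card_level n x y k : n_interval rho n x y -> (k <= n)%N ->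
  #|` level x y k| = (0 < k < n)%N.+1.
Proof.
move=> nxy kn; have := card_level nxy kn; rewrite !Bpow2 -expnD.
case: (posnP k) => [->|k0] /=; first by rewrite subn0 add0n; have := expn_gt0 2 (n - 1); nia.
have [kn'|nk] := ltnP k n; last first.
  have -> : k = n by lia.
  by rewrite subnn addn0; have := expn_gt0 2 (n - 1); nia.
have -> : (n - 1 = (k - 1 + (n - k - 1)).+1)%N by lia.
by rewrite expnS; have := expn_gt0 2 (k - 1 + (n - k - 1)); nia.
Qed.

(** Take an atom [p] below [z]. As [w] has height at least 2, all atoms of [[x, y]] lie below [w],
    in particular [p], and the induction continues in [[p, y]]. *)
Lemma butterfly_le_rank n x y z w : n_interval rho n x y ->
  x <= z <= y -> x <= w <= y -> (rho z < rho w)%N -> z <= w.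
Proof.
elim: n x => [|n IH] x nxy /andP[xz zy] /andP[xw wy] zw;
    have [xy rxy] := (n_intervalP _ _ _).1 nxy;
    have rxz := rho_le xz; have rwy := rho_le wy; first by lia.
have [<-//|nxz] := eqVneq x z.
have rxz' : (rho x < rho z)%N by apply: rho_lt; rewrite lt_neqAle nxz.
have nxz' : n_interval rho (rho z - rho x) x z by [].
have [|p /andP[xp pz] rp] := level_exists nxz' (k := 1); first by lia.
have nxw : n_interval rho (rho w - rho x - 2).+2 x w by split=> //; lia.
have pxy : p \in atoms x y by rewrite in_level xp (le_trans pz zy) rp eqxx.
have Exy : atoms x w = atoms x y.
  case: n nxy rxy {IH} => [|n] nxy rxy; first by lia.
  apply: (atoms_eq wy nxw nxy).
  by rewrite !butterfly_atom_number.
have pw : p <= w by move: pxy; rewrite -Exy in_level => /andP[/andP[]].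
by apply: (IH p (atoms_interval nxy pxy)) => //; apply/andP.
Qed.

Lemma butterfly_isomorphic n x y : n_interval rho n x y ->
  itv_isomorphic x y (butterfly n).
Proof.
move=> nxy; have [xy rxy] := (n_intervalP _ _ _).1 nxy.
(* The boolean coordinate is read as position 0 or 1 in the level; by [size_gt] the default [x] is
   never returned. *)
pose f (a : butterfly n) := nth x (level x y (butterfly_rank a)) (val a).2.
have rank_le (a : butterfly n) : (butterfly_rank a <= n)%N by rewrite -ltnS ltn_ord.
have size_gt (a : butterfly n) : ((val a).2 < #|` level x y (butterfly_rank a)|)%N.
  rewrite (butterfly_card_level nxy (rank_le a)) /butterfly_rank.
  by case: a => -[k []] //= ->.
have fP a : f a \in level x y (butterfly_rank a) by rewrite mem_nth.
have f_itv a : x <= f a <= y by have := fP a; rewrite in_level => /andP[].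
have f_rank a : rho (f a) = (rho x + butterfly_rank a)%N.
  by have := fP a; rewrite in_level => /andP[_ /eqP].
have f_inj : injective f.
  move=> a b E; have Er : butterfly_rank a = butterfly_rank b.
    by have := f_rank a; rewrite E f_rank; lia.
  move/eqP: E; rewrite /f -Er nth_uniq ?fset_uniq//; last by rewrite Er.
  move=> /eqP E; apply/val_inj/eqP; rewrite -pair_eqE /= -val_eqE /=.
  rewrite -/(butterfly_rank a) -/(butterfly_rank b) Er eqxx /=.
  by move: E; case: (val a).2; case: (val b).2.
exists f; split=> [a b|].
  rewrite butterfly_leE; apply/idP/orP => [fab|[/eqP->//|ab]]; last first.
    by apply: (butterfly_le_rank nxy) => //; rewrite !f_rank ltn_add2l.
  have := rho_le fab; rewrite !f_rank leq_add2l leq_eqVlt => /orP[/eqP E|]; last by right.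
  by left; apply/eqP/f_inj/(rho_eq fab); rewrite !f_rank E.
apply/seteqP; split=> [_ [a _ <-]|z xzy]; first exact: f_itv.
have /andP[/rho_le rxz /rho_le rzy] := xzy.
pose k := (rho z - rho x)%N.
have kn : (k < n.+1)%N by rewrite /k; lia.
have zk : z \in level x y k by rewrite in_level xzy /=; apply/eqP; rewrite /k; lia.
pose i := index z (level x y k).
have : (i < (0 < k < n)%N.+1)%N.
  by rewrite -(butterfly_card_level nxy (k := k)) ?index_mem.
move=> ik; have ib : (i == 1)%N ==> (0 < k < n)%N.
  by apply/implyP => /eqP i1; move: ik; rewrite i1; case: (0 < k < n)%N.
exists (exist _ (Ordinal kn, i == 1) ib) => //.
rewrite /f /butterfly_rank /=.
(* A level has at most two elements, so [i] is 0 or 1. *)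
have -> : nat_of_bool (i == 1)%N = i by move: ik; case: (0 < k < n)%N; case: (i) => [|[|]].
by rewrite nth_index.
Qed.

End ButterflyIntervals.

End BinomialPosets.

(** * The dichotomy *)

Theorem theorem2p8 (d : Order.disp_t) (P : bPOrderType d)
    (rho : P -> nat) (B : nat -> nat) :
  binomial_poset rho B -> eulerian rho ->
  let boolean_case :=
    (forall n : nat, B n = n`!) /\
    (forall (n : nat) (x y : P), n_interval rho n x y ->
       itv_isomorphic x y (boolean_algebra n)) in
  let butterfly_case :=
    (B 0 = 1 /\ forall n : nat, 1 <= n -> B n = 2 ^ (n - 1)) /\
    (forall (n : nat) (x y : P), n_interval rho n x y ->
       itv_isomorphic x y (butterfly n)) in
  (boolean_case \/ butterfly_case) /\ ~ (boolean_case /\ butterfly_case).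
Proof.
move=> hP eP boolean_case butterfly_case; split; last first.
  (* The two cases disagree at 3, where the values are 6 and 4. *)
  by move=> [[Bfact _] [[_ Bpow2] _]]; have := Bpow2 3 isT; rewrite Bfact.
have [A3|A3] := atom_number3 hP eP.
  have Bpow2 n : B n = 2 ^ (n - 1) by exact: (factorial_butterfly hP eP).
  right; split=> [|n x y]; last exact: (butterfly_isomorphic hP Bpow2).
  by split=> [|n _]; rewrite Bpow2.
have Bfact n : B n = n`! by exact: (factorial_boolean hP eP).
by left; split=> // n x y; exact: (boolean_isomorphic hP Bfact).
Qed.
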